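(* Let $T$ be a theory over a finite relational vocabulary. Then $T$ is $\omega$-categorical if and only if $T$ satisfies extension properties.
   Context: A theory is $\omega$-categorical if it has a unique countable model up to isomorphism (read as: it has no finite models and exactly one countably infinite model up to isomorphism). Write $[n]=\{1,\dots,n\}$. Extension properties. $T$ satisfies extension properties if for each $k\in\mathbb{Z}^+$ there are formulas $\theta_{k,1}(x_1,\dots,x_k),\dots,\theta_{k,i_k}(x_1,\dots,x_k)$ (called the extension axioms) such that all of the following hold. (1) $T\models\sigma_k$ for each $k$, where $\sigma_k$ is $\forall x_1,\dots,x_k\big(\bigwedge_{1\le i<j\le k}x_i\ne x_j\rightarrow\bigvee_{n=1}^{i_k}\theta_{k,n}(x_1,\dots,x_k)\big)$. (2) For each $k$ and $i\in[i_k]$ there are associated numbers $j_1,\dots,j_m\in[i_{k+1}]$, for some $1\le m\le i_{k+1}$, such that $T\models\tau_{k,i,j}$ for each $j\in\{j_1,\dots,j_m\}$ and $T\models\xi_{k,i}$, where $\tau_{k,i,j}$ is $\forall x_1,\dots,x_k(\theta_{k,i}(x_1,\dots,x_k)\rightarrow\exists z\,\theta_{k+1,j}(x_1,\dots,x_k,z))$ and $\xi_{k,i}$ is $\forall x_1,\dots,x_k\big(\theta_{k,i}(x_1,\dots,x_k)\rightarrow\forall y(\bigwedge_{n=1}^k y\neq x_n\rightarrow\bigvee_{n=1}^m\theta_{k+1,j_n}(x_1,\dots,x_k,y))\big)$. In addition $T\models\tau_{0,1,j}$ for each $j\in[i_1]$, where $\tau_{0,1,j}$ is $\exists z\,\theta_{1,j}(z)$.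 (3) $T\models\forall x_1,\dots,x_k(\theta_{k,i}(x_1,\dots,x_k)\rightarrow\bigwedge_{1\le\alpha<\beta\le k}x_\alpha\neq x_\beta)$ for each $k$ and $i\in[i_k]$. (4) For each $k$ and $i\in[i_k]$ there is an atomic diagram $R$ such that $T\models\forall x_1,\dots,x_k(\theta_{k,i}(x_1,\dots,x_k)\rightarrow R(x_1,\dots,x_k))$. *)

(* Defs.v *)
From mathcomp Require Import all_boot.
From mathcomp Require Import classical_sets cardinality.

Set Implicit Arguments.
Unset Strict Implicit.
Unset Printing Implicit Defensive.

Local Open Scope classical_set_scope.

Record vocabulary := Vocabulary {
  symbol :> finType;
  arity : symbol -> nat }.

(* [formula L n]: first-order formulas over [L] with equality whose free      *)
(* variables are among x_0, ..., x_(n-1). A quantifier binds the last         *)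
(* variable: in [All p] with [p : formula L n.+1] it binds x_n.               *)
Inductive formula (L : vocabulary) : nat -> Type :=
| Bot n : formula L n
| Equ n : 'I_n -> 'I_n -> formula L n
| Rel n (P : L) : (arity P).-tuple 'I_n -> formula L n
| Imp n : formula L n -> formula L n -> formula L n
| All n : formula L n.+1 -> formula L n.

Arguments Bot {L n}.
Arguments Equ {L n}.
Arguments Rel {L n}.

Definition Not (L : vocabulary) n (p : formula L n) : formula L n := Imp p Bot.
Definition Top (L : vocabulary) n : formula L n := Not Bot.
Definition And (L : vocabulary) n (p q : formula L n) : formula L n :=
  Not (Imp p (Not q)).
Definition Or (L : vocabulary) n (p q : formula L n) : formula L n :=
  Imp (Not p) q.
Definition Ex (L : vocabulary) n (p : formula L n.+1) : formula L n :=
  Not (All (Not p)).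

Arguments Top {L n}.

Fixpoint Alls (L : vocabulary) n : formula L n -> formula L 0 :=
  match n with
  | 0 => fun p => p
  | m.+1 => fun p => Alls (All p)
  end.

Definition sentence (L : vocabulary) := formula L 0.
Definition theory (L : vocabulary) := set (sentence L).

Record structure (L : vocabulary) := Structure {
  carrier :> Type;
  carrier_inhabited : inhabited carrier;
  interp : forall P : L, (arity P).-tuple carrier -> Prop }.

Fixpoint holds (L : vocabulary) (M : structure L) n (p : formula L n) :
    n.-tuple M -> Prop :=
  match p in formula _ n return n.-tuple M -> Prop with
  | Bot _ => fun _ => False
  | Equ _ i j => fun a => tnth a i = tnth a j
  | Rel _ P v => fun a => interp (map_tuple (tnth a) v)
  | Imp _ p q => fun a => holds p a -> holds q a
  | All _ p => fun a => forall z : M, holds p (rcons_tuple a z)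
  end.

Definition satisfies (L : vocabulary) (M : structure L) (p : sentence L) :=
  holds p (nil_tuple M).

Definition model (L : vocabulary) (T : theory L) (M : structure L) :=
  forall p, T p -> satisfies M p.

Definition satisfiable (L : vocabulary) (T : theory L) :=
  exists M : structure L, model T M.

Definition entails (L : vocabulary) (T : theory L) (p : sentence L) :=
  forall M : structure L, model T M -> satisfies M p.

Definition isomorphic (L : vocabulary) (M N : structure L) :=
  exists f : M -> N, bijective f /\
    forall (P : L) (v : (arity P).-tuple M),
      interp v <-> interp (map_tuple f v).

Definition countably_infinite (L : vocabulary) (M : structure L) :=
  countable [set: M] /\ infinite_set [set: M].

Definition omega_categorical (L : vocabulary) (T : theory L) :=
  [/\ forall M : structure L, model T M -> infinite_set [set: M],
      exists2 M : structure L, model T M & countably_infinite M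
    & forall M N : structure L,
        model T M -> countably_infinite M ->
        model T N -> countably_infinite N -> isomorphic M N].

Definition literal (L : vocabulary) n (b : bool) (p : formula L n) :=
  if b then p else Not p.

(* [E] and [D] are the sets of equalities and of relational atoms declared    *)
(* true; every other atomic formula in x_0, ..., x_(k-1) is negated.          *)
Definition diagram (L : vocabulary) k (E : {set 'I_k * 'I_k})
    (D : forall P : L, {set (arity P).-tuple 'I_k}) : formula L k :=
  And (\big[@And L k/Top]_(e : 'I_k * 'I_k) literal (e \in E) (Equ e.1 e.2))
      (\big[@And L k/Top]_(P : L) \big[@And L k/Top]_(v : (arity P).-tuple 'I_k)
          literal (v \in D P) (Rel P v)).

(* An atomic diagram in k variables is the complete description of the atomic *)
(* formulas true of some k-tuple of some structure.                           *)
Definition atomic_diagram (L : vocabulary) k (R : formula L k) :=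
  (exists E D, R = diagram E D) /\
  exists (M : structure L) (a : k.-tuple M), holds R a.

Definition distinct (L : vocabulary) k : formula L k :=
  \big[@And L k/Top]_(e : 'I_k * 'I_k | e.1 < e.2) Not (Equ e.1 e.2).

(* In k+1 variables: the last variable differs from all the previous ones.    *)
Definition fresh (L : vocabulary) k : formula L k.+1 :=
  \big[@And L k.+1/Top]_(n < k) Not (Equ ord_max (lift ord_max n)).

Section ExtensionAxioms.
Variables (L : vocabulary) (c : nat -> nat).
Variable theta : forall k, 'I_(c k) -> formula L k.

Definition sigma k : sentence L :=
  Alls (Imp (distinct L k) (\big[@Or L k/Bot]_(n < c k) theta n)).

Definition tau k (i : 'I_(c k)) (j : 'I_(c k.+1)) : sentence L :=
  Alls (Imp (theta i) (Ex (theta j))).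

Definition tau0 (j : 'I_(c 1)) : sentence L := Ex (theta j).

Definition xi k (i : 'I_(c k)) m (j : 'I_m -> 'I_(c k.+1)) : sentence L :=
  Alls (Imp (theta i)
    (All (Imp (fresh L k) (\big[@Or L k.+1/Bot]_(n < m) theta (j n))))).

End ExtensionAxioms.

(* [c k] is the number of extension axioms in k variables; only k > 0 matters *)
(* and [theta] at k = 0 is unconstrained.                                     *)
Definition extension_properties (L : vocabulary) (T : theory L) :=
  exists (c : nat -> nat) (theta : forall k, 'I_(c k) -> formula L k),
  [/\ forall k, 0 < k -> entails T (sigma theta k),
      (forall k, 0 < k -> forall i : 'I_(c k),
         exists m, [/\ 1 <= m, m <= c k.+1 & exists j : 'I_m -> 'I_(c k.+1),
           (forall n : 'I_m, entails T (tau theta i (j n))) /\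
           entails T (xi theta i j)])
      /\ (forall j : 'I_(c 1), entails T (tau0 theta j)),
      forall k, 0 < k -> forall i : 'I_(c k),
        entails T (Alls (Imp (theta k i) (distinct L k)))
    & forall k, 0 < k -> forall i : 'I_(c k),
        exists R : formula L k,
          atomic_diagram R /\ entails T (Alls (Imp (theta k i) R))].

(* Main.v *)
Require Import Defs.
From mathcomp Require Import all_boot.
From mathcomp Require Import boolp classical_sets cardinality filter.

(** A theory with extension properties is omega-categorical by back and forth:
    two tuples satisfying the same extension axiom have the same atomic diagram,
    and the axioms tau and xi let any such pair of tuples be extended by a given
    point on either side ([matching_extend], [back_and_forth]). The same axioms
    make every model infinite, and a countable one is provided by
    [lowenheim_skolem].

    Conversely, let [M] be the countable model of an omega-categorical theory.
    By Lowenheim-Skolem, every tuple of every model has the type of a tuple of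
    [M] ([type_realized]). In particular the theory is complete, and since an
    ultrapower over the natural numbers realizes every sequence of formulas
    that is finitely satisfiable ([realize_sequence]), so does [M]
    ([countably_saturated]). From there on everything happens inside [M]:
    - the types isolated by a single formula are dense ([isolated_dense]), for
      otherwise a sequence of formulas could be refined so as to exclude all the
      countably many tuples of [M] one after the other;
    - hence the Lowenheim-Skolem construction can choose its witnesses so that
      all finite tuples remain isolated. The submodel that it builds is
      isomorphic to [M], so every tuple of [M] is isolated ([all_isolated]);
    - hence there are finitely many types of k-tuples, since otherwise the
      negations of the isolating formulas would be finitely satisfiable
      ([finitely_many_types]).
    The extension axioms are the formulas isolating the types of tuples of
    distinct points. Such a formula decides every formula in the same variables,
    in particular whether the tuple can be extended by a point to satisfy
    another one; this is what the conditions on extension axioms ask. *)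

Set Implicit Arguments.
Unset Strict Implicit.
Unset Printing Implicit Defensive.

Local Open Scope classical_set_scope.

(** * Tuples, formulas and their semantics *)

Section Semantics.
Variable L : vocabulary.

Lemma tnth_rcons_lift (A : Type) n (t : n.-tuple A) z (i : 'I_n) :
  tnth (rcons_tuple t z) (lift ord_max i) = tnth t i.
Proof.
have eq_i : lift ord_max i = i :> nat := lift_max i.
by rewrite !(tnth_nth z) eq_i /= nth_rcons size_tuple ltn_ord.
Qed.

Lemma tnth_rcons_max (A : Type) n (t : n.-tuple A) z :
  tnth (rcons_tuple t z) ord_max = z.
Proof. by rewrite (tnth_nth z) /= nth_rcons size_tuple ltnn eqxx. Qed.

Lemma tuple_rcons (A : Type) n (t : n.+1.-tuple A) :
  exists (s : n.-tuple A) z, t = rcons_tuple s z.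
Proof.
exists [tuple tnth t (lift ord_max i) | i < n], (tnth t ord_max).
apply: eq_from_tnth => i; case: (unliftP ord_max i) => [j ->|->].
  by rewrite tnth_rcons_lift tnth_mktuple.
by rewrite tnth_rcons_max.
Qed.

Lemma map_rcons_tuple (A B : Type) (f : A -> B) n (t : n.-tuple A) z :
  map_tuple f (rcons_tuple t z) = rcons_tuple (map_tuple f t) (f z).
Proof. by apply: val_inj; rewrite /= map_rcons. Qed.

Lemma holds_And (M : structure L) n (p q : formula L n) (a : n.-tuple M) :
  holds (And p q) a <-> holds p a /\ holds q a.
Proof.
rewrite /=; split=> [npq|[hp hq] npq]; last exact: npq.
by split; apply: contrapT => nh; apply: npq.
Qed.

Lemma holds_Or (M : structure L) n (p q : formula L n) (a : n.-tuple M) :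
  holds (Or p q) a <-> holds p a \/ holds q a.
Proof.
split=> /= [npq|[hp np|//]]; last by case: np.
by have [|/npq] := pselect (holds p a); [left|right].
Qed.

Lemma holds_Ex (M : structure L) n (p : formula L n.+1) (a : n.-tuple M) :
  holds (Ex p) a <-> exists z, holds p (rcons_tuple a z).
Proof.
split=> /= [nall|[z pz] /(_ z)//].
by apply: contrapT => nex; apply: nall => z pz; apply: nex; exists z.
Qed.

Lemma holds_literal (M : structure L) n b (p : formula L n) (a : n.-tuple M) :
  holds (literal b p) a <-> (b <-> holds p a).
Proof. case: b => /=; first by split=> [h|[h _]]; [split|apply: h].
by split=> [nh|[_ h] /h//]; split=> // /nh. Qed.

Lemma holds_bigAnd (M : structure L) n (I : finType) (P : pred I)
    (F : I -> formula L n) (a : n.-tuple M) :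
  holds (\big[@And L n/Top]_(i | P i) F i) a <-> forall i, P i -> holds (F i) a.
Proof.
have -> : (forall i, P i -> holds (F i) a) <->
    (forall i, i \in index_enum I -> P i -> holds (F i) a).
  by split=> h i; [move=> _; apply: h | apply: h; rewrite mem_index_enum].
elim: (index_enum I) => [|i s IH]; first by rewrite big_nil; split=> // _ [].
rewrite big_cons; case: ifP => Pi.
  rewrite holds_And IH; split=> [[hi hs] j|h].
    by rewrite inE => /orP[/eqP->//|]; apply: hs.
  by split=> [|j js]; apply: h; rewrite // inE ?eqxx ?js ?orbT.
rewrite IH; split=> h j; last by move=> js; apply: h; rewrite inE js orbT.
by rewrite inE => /orP[/eqP->|]; [rewrite Pi|apply: h].
Qed.

Lemma holds_bigOr (M : structure L) n (I : finType) (F : I -> formula L n)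
    (a : n.-tuple M) :
  holds (\big[@Or L n/Bot]_i F i) a <-> exists i, holds (F i) a.
Proof.
have -> : (exists i, holds (F i) a) <->
    (exists2 i, i \in index_enum I & holds (F i) a).
  by split=> [[i h]|[i _ h]]; exists i; rewrite ?mem_index_enum.
elim: (index_enum I) => [|i s IH]; first by rewrite big_nil; split=> //= -[].
rewrite big_cons holds_Or IH; split=> [[h|[j js h]]|[j]].
- by exists i; rewrite // inE eqxx.
- by exists j; rewrite // inE js orbT.
- by rewrite inE => /orP[/eqP->|js h]; [left|right; exists j].
Qed.

Lemma satisfies_Alls (M : structure L) n (p : formula L n) :
  satisfies M (Alls p) <-> forall a : n.-tuple M, holds p a.
Proof.
elim: n p => [|n IH] p.
  by split=> [h a|]; [rewrite tuple0|apply].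
rewrite /= IH; split=> [h a|h a z]; last exact: h.
by have [s [z ->]] := tuple_rcons a; apply: h.
Qed.

Lemma satisfies_Alls_Imp (M : structure L) n (p q : formula L n) :
  satisfies M (Alls (Imp p q)) <->
  forall a : n.-tuple M, holds p a -> holds q a.
Proof. exact: satisfies_Alls. Qed.

Lemma holds_distinct (M : structure L) k (a : k.-tuple M) :
  holds (distinct L k) a <-> injective (tnth a).
Proof.
rewrite holds_bigAnd; split=> [h i j eq_a|inj_a [i j] /= ltij /inj_a eqij].
  apply: val_inj; case: (ltngtP i j) => // ltij.
    by case: (h (i, j) ltij).
  by case: (h (j, i) ltij).
by rewrite eqij ltnn in ltij.
Qed.

Lemma holds_fresh (M : structure L) k (a : k.-tuple M) z :
  holds (fresh L k) (rcons_tuple a z) <-> forall i, z <> tnth a i.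
Proof.
rewrite holds_bigAnd; split=> h i => [eqz|_].
  by case: (h i isT); rewrite /= tnth_rcons_lift tnth_rcons_max.
by rewrite /= tnth_rcons_lift tnth_rcons_max; apply: h.
Qed.

Lemma injective_rcons (A : Type) k (a : k.-tuple A) z :
  injective (tnth (rcons_tuple a z)) <->
  injective (tnth a) /\ forall i, z <> tnth a i.
Proof.
split=> [inj_az|[inj_a za] i j].
  split=> [i j eq_a|i eqz].
    by apply: (@lift_inj _ ord_max); apply: inj_az; rewrite !tnth_rcons_lift.
  have /eqP : ord_max = lift ord_max i.
    by apply: inj_az; rewrite tnth_rcons_lift tnth_rcons_max.
  by rewrite (negPf (neq_lift _ _)).
case: (unliftP ord_max i) => [i' ->|->];
  case: (unliftP ord_max j) => [j' ->|->];
  rewrite ?tnth_rcons_lift ?tnth_rcons_max => // eq_a.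
- by rewrite (inj_a _ _ eq_a).
- by case: (za i').
- by case: (za j').
Qed.

Definition diagram_of (M : structure L) k (a : k.-tuple M) : formula L k :=
  diagram [set e : 'I_k * 'I_k | `[< tnth a e.1 = tnth a e.2 >]]%SET
    (fun P => [set v : (arity P).-tuple 'I_k
                 | `[< interp (map_tuple (tnth a) v) >]]%SET).

Lemma holds_diagram_of (M : structure L) k (a : k.-tuple M) :
  holds (diagram_of a) a.
Proof.
apply/holds_And; split; apply/holds_bigAnd; [move=> e _|move=> P _].
  by apply/holds_literal; rewrite inE /=; split=> /asboolP.
apply/holds_bigAnd => v _; apply/holds_literal.
by rewrite inE /=; split=> /asboolP.
Qed.

Lemma atomic_diagram_of (M : structure L) k (a : k.-tuple M) :
  atomic_diagram (diagram_of a).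
Proof.
by split; [do 2!eexists | exists M, a; apply: holds_diagram_of].
Qed.

Lemma holds_diagram_rel (M N : structure L) k E D (a : k.-tuple M)
    (b : k.-tuple N) (P : L) (w : (arity P).-tuple 'I_k) :
  holds (@diagram L k E D) a -> holds (@diagram L k E D) b ->
  interp (map_tuple (tnth a) w) <-> interp (map_tuple (tnth b) w).
Proof.
move=> /holds_And[_ /holds_bigAnd/(_ P isT)/holds_bigAnd/(_ w isT)].
move=> /holds_literal /= <-.
move=> /holds_And[_ /holds_bigAnd/(_ P isT)/holds_bigAnd/(_ w isT)].
by move/holds_literal.
Qed.

Definition lift_var n m (f : 'I_n -> 'I_m) (i : 'I_n.+1) : 'I_m.+1 :=
  if unlift ord_max i is Some j then lift ord_max (f j) else ord_max.

Fixpoint rename n (p : formula L n) : forall m, ('I_n -> 'I_m) -> formula L m :=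
  match p in formula _ n return forall m, ('I_n -> 'I_m) -> formula L m with
  | Bot _ => fun m f => Bot
  | Equ _ i j => fun m f => Equ (f i) (f j)
  | Rel _ P v => fun m f => Rel P (map_tuple f v)
  | Imp _ p q => fun m f => Imp (rename p f) (rename q f)
  | All _ p => fun m f => All (rename p (lift_var f))
  end.

Lemma holds_rename (M : structure L) n (p : formula L n) m (f : 'I_n -> 'I_m)
    (a : m.-tuple M) :
  holds (rename p f) a <-> holds p [tuple tnth a (f i) | i < n].
Proof.
elim: p m f a => {n} [n|n i j|n P v|n p IHp q IHq|n p IH] m f a //=.
- by rewrite !tnth_mktuple.
- suff -> : map_tuple (tnth a) (map_tuple f v) =
            map_tuple (tnth [tuple tnth a (f i) | i < n]) v by [].
  by apply: eq_from_tnth => i; rewrite !tnth_map tnth_ord_tuple.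
- by rewrite IHp IHq.
- have eq_az z : [tuple tnth (rcons_tuple a z) (lift_var f i) | i < n.+1] =
      rcons_tuple [tuple tnth a (f i) | i < n] z.
    apply: eq_from_tnth => i; rewrite tnth_mktuple /lift_var.
    case: unliftP => [j ->|->]; last by rewrite !tnth_rcons_max.
    by rewrite !tnth_rcons_lift tnth_mktuple.
  by split=> h z; have := h z; rewrite IH eq_az.
Qed.

Definition weaken n (p : formula L n) : formula L n.+1 :=
  rename p (lift ord_max).

Lemma holds_weaken (M : structure L) n (p : formula L n) (a : n.-tuple M) z :
  holds (weaken p) (rcons_tuple a z) <-> holds p a.
Proof.
rewrite holds_rename.
suff -> : [tuple tnth (rcons_tuple a z) (lift ord_max i) | i < n] = a by [].
by apply: eq_from_tnth => i; rewrite tnth_mktuple tnth_rcons_lift.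
Qed.

(** Eliminating the trailing variables one by one: [Ex] binds the last one. *)
Lemma projection_definable k m (p : formula L m) : k <= m ->
  exists q : formula L k, forall (M : structure L) (b : k.-tuple M),
    holds q b <-> exists2 u : m.-tuple M, holds p u & take k u = b.
Proof.
elim: m p => [|m IH] p.
  rewrite leqn0 => /eqP ->; exists p => M b; split=> [h|[u]].
    by exists b; rewrite // take_oversize ?size_tuple.
  by rewrite (tuple0 u) (tuple0 b).
rewrite leq_eqVlt => /predU1P[->|]; last rewrite ltnS => lekm.
  exists p => M b; split=> [h|[u]].
    by exists b; rewrite // take_oversize ?size_tuple.
  by rewrite take_oversize ?size_tuple // => h /val_inj <-.
have [q qP] := IH (Ex p) lekm; exists q => M b; rewrite qP; split.
  case=> u /holds_Ex[z h] eq_b; exists (rcons_tuple u z) => //=.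
  by rewrite -cats1 takel_cat // size_tuple.
case=> u'; have [u [z ->]] := tuple_rcons u' => h eq_b.
exists u; first by apply/holds_Ex; exists z.
by rewrite -eq_b /= -cats1 takel_cat // size_tuple.
Qed.

(** The witness quantifies over a copy of the big tuple placed after the
    variables of the small one, and equates the latter with their sources. *)
Lemma image_definable n (p : formula L n) k (f : 'I_k -> 'I_n) :
  exists q : formula L k, forall (M : structure L) (b : k.-tuple M),
    holds q b <->
    exists2 c : n.-tuple M, holds p c & b = [tuple tnth c (f i) | i < k].
Proof.
pose r := And (rename p (@rshift k n))
  (\big[@And L (k + n)/Top]_(i < k) Equ (lshift n i) (rshift k (f i))).
have [q qP] := projection_definable r (leq_addr n k); exists q => M b.
have rP (d : k.-tuple M) (c : n.-tuple M) : holds r (cat_tuple d c) <->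
    holds p c /\ d = [tuple tnth c (f i) | i < k].
  have tl i : tnth (cat_tuple d c) (lshift n i) = tnth d i.
    by rewrite tnth_lshift.
  have tr i : tnth (cat_tuple d c) (rshift k i) = tnth c i.
    by rewrite tnth_rshift.
  rewrite holds_And holds_rename holds_bigAnd.
  have -> : [tuple tnth (cat_tuple d c) (rshift k i) | i < n] = c.
    by apply: eq_from_tnth => i; rewrite tnth_mktuple tr.
  split=> -[pc h]; split=> //.
    apply: eq_from_tnth => i; rewrite tnth_mktuple.
    by have /= := h i isT; rewrite tl tr.
  by move=> i _; rewrite /= tl tr h tnth_mktuple.
rewrite qP; split=> [[u ru eq_b]|[c pc eq_b]].
  have sz : size (drop k u) == n by rewrite size_drop size_tuple addKn.
  suff /rP[] : holds r (cat_tuple b (Tuple sz)) by exists (Tuple sz).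
  have -> // : cat_tuple b (Tuple sz) = u.
  by apply: val_inj; rewrite /= -eq_b cat_take_drop.
exists (cat_tuple b c); first by apply/rP.
by rewrite /= take_size_cat // size_tuple.
Qed.

End Semantics.

(** * Elementary embeddings and countable elementary submodels *)

Lemma injective_cancel (A B : Type) (f : A -> B) (x0 : A) :
  injective f -> exists g, cancel f g.
Proof.
move=> inj_f.
have /choice[g gP] : forall y, exists x, forall x', f x' = y -> x = x'.
  move=> y; have [[x eqy]|nex] := pselect (exists x, f x = y).
    by exists x => x'; rewrite -eqy => /inj_f.
  by exists x0 => x' eqy; case: nex; exists x'.
by exists g => x; apply: gP.
Qed.

Section Countability.
Variable L : vocabulary.

Fixpoint encode n (p : formula L n) : GenTree.tree nat :=
  match p with
  | Bot _ => GenTree.Node 0 [::]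
  | Equ _ i j => GenTree.Node 1
      [:: GenTree.Leaf (i : nat); GenTree.Leaf (j : nat)]
  | Rel _ P v => GenTree.Node 2
      (GenTree.Leaf (enum_rank P : nat)
        :: [seq GenTree.Leaf (nat_of_ord i) | i <- v])
  | Imp _ p q => GenTree.Node 3 [:: encode p; encode q]
  | All _ p => GenTree.Node 4 [:: encode p]
  end.

Lemma encode_inj n : injective (@encode n).
Proof.
move=> p; elim: p => {n} [n|n i j|n P v|n p IHp q IHq|n p IH] r.
- by case: n / r.
- by case: n / r i j => //= n i' j' i j [/val_inj-> /val_inj->].
- case: n / r v => //= n P' v' v [/val_inj/enum_rank_inj eqP].
  case: P' / eqP v' => v' eqv; congr Rel; apply: val_inj.
  by apply: (inj_map _ eqv) => i j [/val_inj].
- case: n / r p IHp q IHq => //= n p' q' p IHp q IHq [/IHp-> /IHq->] //.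
- by case: n / r p IH => //= n p' p IH [/IH->].
Qed.

Definition code n (p : formula L n) : nat := pickle (encode p).

Lemma code_inj n : injective (@code n).
Proof. by move=> p q /(pcan_inj pickleK)/encode_inj. Qed.

Definition decode n : nat -> formula L n :=
  sval (cid (injective_cancel Bot (@code_inj n))).

Lemma codeK n : cancel (@code n) (@decode n).
Proof. by rewrite /decode; case: cid. Qed.

End Countability.

Lemma countable_surjection (A : Type) : inhabited A -> countable [set: A] ->
  exists e : nat -> A, forall x, exists n, e n = x.
Proof.
move=> [x0] /countable_injP[f inj_f].
have [|g gK] := @injective_cancel _ _ f x0; first by apply: in2TT.
by exists g => x; exists (f x).
Qed.

Lemma countable_tuples (A : Type) k : inhabited A -> countable [set: A] ->
  exists e : nat -> k.-tuple A, forall t, exists n, e n = t.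
Proof.
move=> A0 /(countable_surjection A0)[e eP].
exists (fun n => map_tuple e (odflt [tuple 0 | _ < k] (unpickle n))) => t.
have /choice[f fP] : forall i : 'I_k, exists m, e m = tnth t i.
  by move=> i; apply: eP.
exists (pickle [tuple f i | i < k]); rewrite pickleK /=.
by apply: eq_from_tnth => i; rewrite tnth_map tnth_mktuple.
Qed.

Section Embeddings.
Variable L : vocabulary.

Definition elementary (N M : structure L) (h : N -> M) :=
  forall n (p : formula L n) (t : n.-tuple N),
    holds p t <-> holds p (map_tuple h t).

Lemma elementary_satisfies (N M : structure L) (h : N -> M) (p : sentence L) :
  elementary h -> satisfies N p <-> satisfies M p.
Proof. by move=> el_h; rewrite /satisfies el_h (tuple0 (map_tuple _ _)). Qed.

Lemma elementary_model (T : theory L) (N M : structure L) (h : N -> M) :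
  elementary h -> model T M -> model T N.
Proof. by move=> el_h modM p /modM /(elementary_satisfies p el_h). Qed.

(** The Tarski-Vaught test. *)
Lemma tarski_vaught (N M : structure L) (h : N -> M) : injective h ->
  (forall (P : L) (v : (arity P).-tuple N),
     interp v <-> interp (map_tuple h v)) ->
  (forall n (p : formula L n.+1) (t : n.-tuple N),
     (exists z, holds p (rcons_tuple (map_tuple h t) z)) ->
     exists z, holds p (rcons_tuple (map_tuple h t) (h z))) ->
  elementary h.
Proof.
move=> inj_h int_h test n p.
elim: p => {n} [n|n i j|n P v|n p IHp q IHq|n p IH] t //=.
- by rewrite !tnth_map; split=> [->//|/inj_h].
- rewrite int_h; suff -> : map_tuple h (map_tuple (tnth t) v) =
    map_tuple (tnth (map_tuple h t)) v by [].
  by apply: eq_from_tnth => i; rewrite !tnth_map.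
- by rewrite IHp IHq.
split=> h_p z; last by rewrite IH map_rcons_tuple; apply: h_p.
apply: contrapT => npz.
have [|w] := test n (Not p) t; first by exists z.
by apply; have /IH := h_p w; rewrite map_rcons_tuple.
Qed.

Lemma isomorphic_elementary (M N : structure L) : isomorphic M N ->
  exists2 f : M -> N, bijective f & elementary f.
Proof.
move=> [f [bij_f int_f]]; exists f => //.
apply: tarski_vaught => // [|n p t [z pz]]; first exact: bij_inj.
by have [g _ gK] := bij_f; exists (g z); rewrite gK.
Qed.

(** Stage [n] of the construction of a countable submodel looks for a witness
    of a formula about the first [n] points. The last component of the code
    is padding, so that every formula comes back at arbitrarily late stages. *)
Definition task n : formula L n.+1 :=
  match (unpickle n : option (nat * nat * seq nat * nat)) with
  | Some (m, c, s, _) => rename (decode L m.+1 c) (fun i => inord (nth n s i))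
  | None => Bot
  end.

(** The padding is chosen so large that the stage comes after [k] and after all
    the indices in [s]. *)
Lemma taskP (M : structure L) m (p : formula L m.+1) (s : m.-tuple nat) k :
  exists2 n, k <= n & (forall i, tnth s i < n) /\
    forall (a : n.-tuple M) (b : m.-tuple M) z,
      (forall (i : 'I_m) (j : 'I_n), tnth s i = j -> tnth b i = tnth a j) ->
      holds (task n) (rcons_tuple a z) <-> holds p (rcons_tuple b z).
Proof.
pose pad (d : nat) := pickle (m, code p, val s, d).
have inj_pad : injective pad by move=> d d' /(pcan_inj pickleK)[].
have [d] := injective_gtn inj_pad (maxn k (\max_(i < m) tnth s i)).
rewrite gtn_max => /andP[ltk lts]; exists (pad d); first exact: ltnW.
have lt_s i : tnth s i < pad d.
  by apply: leq_ltn_trans lts; apply: leq_bigmax.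
split=> // a b z eq_ab; rewrite /task {1}/pad pickleK /= codeK.
rewrite holds_rename.
suff -> : [tuple tnth (rcons_tuple a z) (inord (nth (pad d) s i)) | i < m.+1] =
          rcons_tuple b z by [].
apply: eq_from_tnth => i; rewrite tnth_mktuple.
case: (unliftP ord_max i) => [j ->|->].
  have eq_j : lift ord_max j = j :> nat := lift_max j.
  rewrite tnth_rcons_lift eq_j -tnth_nth.
  rewrite (eq_ab j (Ordinal (lt_s j))) // -(tnth_rcons_lift a z).
  congr (tnth _ _); apply: val_inj; rewrite /= inordK ?ltnS 1?ltnW //.
  by rewrite /bump leqNgt lt_s.
rewrite tnth_rcons_max nth_default ?size_tuple //.
suff -> : inord (pad d) = ord_max :> 'I_(pad d).+1 by rewrite tnth_rcons_max.
by apply: val_inj; rewrite /= inordK.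
Qed.

(** Starting from [a0], stage [n] appends a witness of [task n] if there is one,
    and any point that keeps the tuple [good] otherwise. *)
Lemma exhaustion (M : structure L) (good : forall n, n.-tuple M -> Prop)
    k (a0 : k.-tuple M) : good k a0 ->
  (forall n (a : n.-tuple M) (p : formula L n.+1), good n a ->
     (exists z, holds p (rcons_tuple a z)) ->
     exists z, holds p (rcons_tuple a z) /\ good n.+1 (rcons_tuple a z)) ->
  exists a : nat -> M, [/\ a0 = [tuple a i | i < k],
    forall n, k <= n -> good n [tuple a i | i < n]
    & forall m (p : formula L m.+1) (s : m.-tuple nat),
      (exists z, holds p (rcons_tuple (map_tuple a s) z)) ->
      exists j, holds p (rcons_tuple (map_tuple a s) (a j))].
Proof.
move=> good0 extend.
have next n (a : n.-tuple M) : exists z, good n a ->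
    good n.+1 (rcons_tuple a z) /\
    ((exists w, holds (task n) (rcons_tuple a w)) ->
     holds (task n) (rcons_tuple a z)).
  have [x0] := carrier_inhabited M.
  have [ga|] := pselect (good n a); last by exists x0.
  have [ex|nex] := pselect (exists w, holds (task n) (rcons_tuple a w)).
    by have [z [hz gz]] := extend n a _ ga ex; exists z.
  have [|z [_ gz]] := extend n a Top ga; first by exists x0.
  by exists z.
pose pick n (a : n.-tuple M) := sval (cid (next n a)).
have pickP n (a : n.-tuple M) := svalP (cid (next n a)).
pose fix st N : (N + k).-tuple M :=
  if N is N'.+1 then rcons_tuple (st N') (pick _ (st N')) else a0.
have st_good N : good (N + k) (st N).
  by elim: N => // N IH; apply: (pickP _ (st N) IH).1.
have [x0] := carrier_inhabited M.
pose a i := nth x0 (st i.+1) i.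
have st_mono d N i : i < N + k -> nth x0 (st (d + N)) i = nth x0 (st N) i.
  move=> ltiN; elim: d => //= d <-; rewrite nth_rcons size_tuple.
  suff -> : i < d + N + k by [].
  by rewrite -addnA (leq_trans ltiN) ?leq_addl.
have st_a N : st N = [tuple a i | i < N + k].
  apply: eq_from_tnth => i; rewrite tnth_mktuple (tnth_nth x0) /a.
  rewrite -(st_mono i.+1) // -[RHS](st_mono N) ?leq_addr //.
  by rewrite (addnC i.+1 N).
exists a; split=> [|n|m p s [z hz]].
- exact: st_a 0.
- by move/subnK => <-; rewrite -st_a.
have [n /subnK] := taskP M p s k; move: (n - k) => N <- [lt_s taskE].
have eq_s (i : 'I_m) (j : 'I_(N + k)) : tnth s i = j ->
    tnth (map_tuple a s) i = tnth (st N) j.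
  by move=> eq_ij; rewrite st_a tnth_mktuple tnth_map eq_ij.
exists (N + k); have -> : a (N + k) = pick _ (st N).
  have := congr1 (fun t : (N + k).+1.-tuple M => tnth t ord_max) (st_a N.+1).
  by rewrite [LHS]tnth_rcons_max tnth_mktuple.
apply/(taskE _ _ _ eq_s); apply: (pickP _ (st N) (st_good N)).2.
by exists z; apply/(taskE _ _ _ eq_s).
Qed.

(** The points are the least indices of the values of the sequence, so that
    countability is inherited from the natural numbers. *)
Program Definition range_structure (M : structure L) (a : nat -> M) :=
  @Structure L {i : nat | `[< forall j, j < i -> a j <> a i >]} _
    (fun P v => interp (map_tuple (fun i => a (val i)) v)).
Next Obligation.
by move=> M a; constructor; exists 0; apply/asboolP.
Qed.

(** The Lowenheim-Skolem theorem, with control over the types of the tuples of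
    the submodel: each one is part of some [good] tuple. *)
Theorem countable_elementary_submodel (M : structure L)
    (good : forall n, n.-tuple M -> Prop) k (a0 : k.-tuple M) :
  good k a0 ->
  (forall n (a : n.-tuple M) (p : formula L n.+1), good n a ->
     (exists z, holds p (rcons_tuple a z)) ->
     exists z, holds p (rcons_tuple a z) /\ good n.+1 (rcons_tuple a z)) ->
  exists (N : structure L) (h : N -> M), [/\ countable [set: N], elementary h,
    exists b : k.-tuple N, map_tuple h b = a0
    & forall m (t : m.-tuple N), exists n (a : n.-tuple M) (f : 'I_m -> 'I_n),
        good n a /\ map_tuple h t = [tuple tnth a (f i) | i < m]].
Proof.
move=> good0 /(exhaustion good0)[a [a0E a_good test]].
pose N := range_structure a; pose h (i : N) := a (val i).
have /choice[r rP] : forall n, exists i : N, h i = a n.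
  move=> n; have ex : exists m, `[< a m = a n >] by exists n; apply/asboolP.
  case: (ex_minnP ex) => m /asboolP eq_m min_m.
  suff new_m : `[< forall j, j < m -> a j <> a m >] by exists (exist _ m new_m).
  apply/asboolP => j ltjm eq_j; suff : m <= j by rewrite leqNgt ltjm.
  by apply: min_m; apply/asboolP; rewrite eq_j.
have inj_h : injective h.
  move=> i j eq_a; apply: val_inj.
  have /asboolP new_i := valP i; have /asboolP new_j := valP j.
  by case: (ltngtP (val i) (val j)) => // [/new_j|/new_i]; rewrite -/(h i) eq_a.
have map_h m (t : m.-tuple N) : map_tuple h t = map_tuple a (map_tuple val t).
  by apply: eq_from_tnth => i; rewrite !tnth_map.
exists N, h; split.
- exact: countableP.
- apply: tarski_vaught => // n p t; rewrite map_h => /test[j pj].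
  by exists (r j); rewrite rP.
- exists [tuple r i | i < k]; rewrite a0E.
  by apply: eq_from_tnth => i; rewrite tnth_map !tnth_mktuple rP.
move=> m t; pose n := maxn k (\max_(i < m) val (tnth t i)).+1.
have lt_t i : val (tnth t i) < n.
  rewrite leq_max; apply/orP; right.
  exact: (leq_bigmax (F := fun i => val (tnth t i))).
exists n, [tuple a i | i < n], (fun i => Ordinal (lt_t i)).
split; first by apply: a_good; rewrite leq_maxl.
by apply: eq_from_tnth => i; rewrite tnth_map !tnth_mktuple.
Qed.

Corollary lowenheim_skolem (M : structure L) k (a : k.-tuple M) :
  exists (N : structure L) (h : N -> M),
    [/\ countable [set: N], elementary h
      & exists b : k.-tuple N, map_tuple h b = a].
Proof.
have [|n b p _ [z pz]|N [h [cN el_h ex_b _]]] :=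
  @countable_elementary_submodel M (fun _ _ => True) k a => //.
  by exists z.
by exists N, h.
Qed.

End Embeddings.

(** * Ultrapowers *)

Section Ultrapower.
Variables (L : vocabulary) (M : structure L) (U : set_system nat).
Hypothesis ultraU : UltraFilter U.

Definition agree (f g : nat -> M) := U [set i | f i = g i].

Lemma agreeC f g : agree f g -> agree g f.
Proof. by apply: filterS => i /=. Qed.

Lemma agree_trans f g h : agree f g -> agree g h -> agree f h.
Proof. by apply: filterS2 => i /= ->. Qed.

Lemma agree_refl f : agree f f.
Proof. by apply: filterE. Qed.

Definition class_repr (f : nat -> M) : nat -> M :=
  sval (cid (ex_intro (agree f) f (agree_refl f))).

Lemma agree_class_repr f : agree f (class_repr f).
Proof. by rewrite /class_repr; case: cid. Qed.

Lemma class_repr_eq f g : agree f g -> class_repr f = class_repr g.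
Proof.
move=> fg.
have eq_fg : agree f = agree g.
  apply: funext => h; apply/propext; split; apply: agree_trans => //.
  exact: agreeC.
have cid_eq (P Q : (nat -> M) -> Prop) (p : exists x, P x) (q : exists x, Q x) :
    P = Q -> sval (cid p) = sval (cid q).
  by move=> eqPQ; case: Q / eqPQ q => q; rewrite (Prop_irrelevance p q).
exact: cid_eq.
Qed.

(** A class of sequences is represented by its canonical member. *)
Program Definition ultrapower :=
  @Structure L {f : nat -> M | class_repr f = f} _
    (fun P v => U [set i | interp (map_tuple (fun f => sval f i) v)]).
Next Obligation.
have [x] := carrier_inhabited M; constructor; exists (class_repr (fun=> x)).
by apply: class_repr_eq; apply/agreeC/agree_class_repr.
Qed.

Lemma ultrapower_class (f : nat -> M) :
  exists u : ultrapower, agree f (sval u).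
Proof.
have rr : class_repr (class_repr f) = class_repr f.
  by apply: class_repr_eq; apply/agreeC/agree_class_repr.
by exists (exist (fun g => class_repr g = g) _ rr); apply: agree_class_repr.
Qed.

Definition coordinate i (u : ultrapower) : M := sval u i.

(** The theorem of Los. *)
Lemma holds_ultrapower n (p : formula L n) (t : n.-tuple ultrapower) :
  holds p t <-> U [set i | holds p (map_tuple (coordinate i) t)].
Proof.
elim: p t => {n} [n|n i j|n P v|n p IHp q IHq|n p IH] t /=.
- split=> // /filter_ex[].
  by [].
- have -> : [set l | tnth (map_tuple (coordinate l) t) i =
                     tnth (map_tuple (coordinate l) t) j] =
            [set l | sval (tnth t i) l = sval (tnth t j) l].
    by apply: funext => l /=; rewrite !tnth_map.
  split=> [->|]; first exact: agree_refl.
  case: (tnth t i) (tnth t j) => [f fr] [g gr] /= /class_repr_eq.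
  by rewrite fr gr => eq_fg; apply: eq_exist.
- have eq_v l : map_tuple (tnth (map_tuple (coordinate l) t)) v =
               map_tuple (coordinate l) (map_tuple (tnth t) v).
    by apply: eq_from_tnth => i; rewrite !tnth_map.
  by split; apply: filterS => l /=; rewrite eq_v.
- rewrite IHp IHq; split=> [pq|]; last by apply: filterS2 => i /= h; apply: h.
  have [/pq|] := in_ultra_setVsetC
    [set i | holds p (map_tuple (coordinate i) t)] ultraU.
    by apply: filterS => i /= h _.
  by apply: filterS => i /= np /np.
split=> [all_p|U_p z]; last first.
  apply/IH; apply: filterS U_p => i /= /(_ (coordinate i z)).
  by rewrite map_rcons_tuple.
(* [f i] is a counterexample at every coordinate [i] that has one. *)
have /choice[f fP] : forall i, exists z,
    holds p (rcons_tuple (map_tuple (coordinate i) t) z) ->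
    forall w, holds p (rcons_tuple (map_tuple (coordinate i) t) w).
  move=> i; have [x] := carrier_inhabited M.
  have [all_i|] := pselect (forall w,
      holds p (rcons_tuple (map_tuple (coordinate i) t) w)).
    by exists x.
  by move/existsNP=> [w nw]; exists w.
have [u fu] := ultrapower_class f.
move/IH: (all_p u); apply: filterS2 fu => i /= eq_fu; rewrite map_rcons_tuple.
by rewrite -[coordinate i u]/(sval u i) -eq_fu => /fP.
Qed.

End Ultrapower.

(** The class of a sequence of tuples [a n], each satisfying the first [n]
    formulas, satisfies all of them in a nonprincipal ultrapower. *)
Theorem realize_sequence (L : vocabulary) (M : structure L) k
    (p : nat -> formula L k) :
  (forall n, exists a : k.-tuple M, forall i, i < n -> holds (p i) a) ->
  exists (N : structure L) (b : k.-tuple N),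
    (forall i, holds (p i) b) /\
    forall q : sentence L, satisfies M q <-> satisfies N q.
Proof.
move=> /choice[a aP].
have [U [ultraU subU]] := ultraFilterLemma eventually_filter.
(* The ultrafilter [U] contains the cofinite sets, so is nonprincipal. *)
exists (ultrapower M ultraU).
have /choice[b bP] : forall i : 'I_k, exists u : ultrapower M ultraU,
    agree U (fun n => tnth (a n) i) (sval u).
  by move=> i; apply: ultrapower_class.
exists [tuple b i | i < k]; split=> [l|q]; last first.
  rewrite /satisfies holds_ultrapower; split=> [hq|/filter_ex[i] /=].
    by apply: filterE => i /=; rewrite tuple0.
  by rewrite (tuple0 (map_tuple _ _)).
apply/holds_ultrapower.
have U_ab : U [set n | forall i, tnth (a n) i = coordinate n (b i)].
  by apply: filter_forall => i; apply: bP.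
have U_l : U [set n | l < n] by apply: subU; exists l.+1.
apply: filterS2 U_ab U_l => n /= eq_ab /(aP n).
suff -> // : a n = map_tuple (coordinate n) [tuple b i | i < k] by [].
by apply: eq_from_tnth => i; rewrite tnth_map tnth_mktuple.
Qed.

(** * Types of tuples in the countable model of an omega-categorical theory *)

Section Categorical.
Variables (L : vocabulary) (T : theory L).
Hypothesis catT : omega_categorical T.
Variable M : structure L.
Hypotheses (modM : model T M) (countM : countably_infinite M).

(** By Lowenheim-Skolem the tuple may be taken in a countable model, which is
    isomorphic to [M]. *)
Lemma type_realized (N : structure L) k (a : k.-tuple N) : model T N ->
  exists b : k.-tuple M, forall p : formula L k, holds p a <-> holds p b.
Proof.
move=> modN; have [N' [h [cN' el_h [b' hb']]]] := lowenheim_skolem a.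
have modN' := elementary_model el_h modN.
have [inf_models _ unique] := catT.
have [f _ el_f] := isomorphic_elementary
  (unique N' M modN' (conj cN' (inf_models _ modN')) modM countM).
by exists (map_tuple f b') => p; rewrite -hb' -el_h -el_f.
Qed.

Lemma entails_satisfies p : entails T p <-> satisfies M p.
Proof.
split=> [/(_ M modM)//|Mp N modN].
have [b bP] := type_realized (nil_tuple N) modN.
by apply/bP; rewrite (tuple0 b).
Qed.

Lemma countably_saturated k (p : nat -> formula L k) :
  (forall n, exists a : k.-tuple M, forall i, i < n -> holds (p i) a) ->
  exists b : k.-tuple M, forall i, holds (p i) b.
Proof.
move=> /realize_sequence[N [a [aP MN]]].
have modN : model T N by move=> q /modM /MN.
have [b bP] := type_realized a modN.
by exists b => i; apply/bP.
Qed.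

(** Isolation of a type over the theory of [M], said semantically. An
    unsatisfiable [p] also qualifies. *)
Definition complete k (p : formula L k) :=
  forall q : formula L k,
    (forall a : k.-tuple M, holds p a -> holds q a) \/
    (forall a : k.-tuple M, holds p a -> ~ holds q a).

Lemma complete_holds k (p q : formula L k) (a b : k.-tuple M) :
  complete p -> holds p a -> holds q a -> holds p b -> holds q b.
Proof. by move=> /(_ q)[all_q pa _|nq pa /(nq _ pa)//]; apply: all_q. Qed.

Definition isolated k (a : k.-tuple M) :=
  exists2 p : formula L k, complete p & holds p a.

(** Isolated types are dense. Otherwise each satisfiable refinement of [p] can
    be refined so as to exclude any given tuple; excluding all tuples of the
    countable [M] one after the other contradicts saturation. *)
Lemma isolated_dense k (p : formula L k) (a : k.-tuple M) : holds p a ->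
  exists q : formula L k, [/\ complete q, exists b : k.-tuple M, holds q b
    & forall b : k.-tuple M, holds q b -> holds p b].
Proof.
move=> pa; apply: contrapT => none.
pose below (r q : formula L k) :=
  (exists b : k.-tuple M, holds q b) /\
  (forall b : k.-tuple M, holds q b -> holds r b).
have [e eP] := countable_tuples k (carrier_inhabited M) countM.1.
have split_type n q : exists q', below p q -> below q q' /\ ~ holds q' (e n).
  have [bq|] := pselect (below p q); last by exists q.
  have [r nr] : exists r : formula L k,
      ~ ((forall b : k.-tuple M, holds q b -> holds r b) \/
         (forall b : k.-tuple M, holds q b -> ~ holds r b)).
    apply: contrapT => all_r; apply: none; exists q.
    split; [|exact: bq.1|exact: bq.2] => r.
    by apply: contrapT => nr; apply: all_r; exists r.
  have [b1 qb1 nr1] : exists2 b : k.-tuple M, holds q b & ~ holds r b.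
    apply: contrapT => nb; apply: nr; left => b qb.
    by apply: contrapT => nrb; apply: nb; exists b.
  have [b2 qb2 r2] : exists2 b : k.-tuple M, holds q b & holds r b.
    apply: contrapT => nb; apply: nr; right => b qb rb.
    by apply: nb; exists b.
  (* The tuple [e n] is excluded by the side of [r] on which it does not lie. *)
  have [re|nre] := pselect (holds r (e n)).
    exists (And q (Not r)) => _; split; last by move/holds_And => -[_ /(_ re)].
    split; first by exists b1; apply/holds_And.
    by move=> b /holds_And[].
  exists (And q r) => _; split; last by move/holds_And => -[_ /nre].
  split; first by exists b2; apply/holds_And.
  by move=> b /holds_And[].
pose next n q := sval (cid (split_type n q)).
have nextP n q : below p q -> below q (next n q) /\ ~ holds (next n q) (e n) :=
  svalP (cid (split_type n q)).
pose fix s n := if n is m.+1 then next m (s m) else p.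
have s_p n : below p (s n).
  elim: n => [|n IH]; first by split=> //; exists a.
  have [[ex_b sub] _] := nextP n _ IH.
  by split=> // b /sub; apply: IH.2.
have s_dec m n (b : k.-tuple M) : m <= n -> holds (s n) b -> holds (s m) b.
  move/subnK => <-; elim: (n - m) => //= d IH h; apply: IH.
  exact: (nextP (d + m) _ (s_p _)).1.2 b h.
have [|b b_s] := @countably_saturated k s.
  move=> n; have [[b b_s] _] := s_p n.
  by exists b => i /ltnW lein; apply: s_dec b_s.
have [n eq_b] := eP b.
by apply: (nextP n _ (s_p n)).2; rewrite eq_b; apply: (b_s n.+1).
Qed.

(** With [r] isolating [a], density gives a complete [q] below [r /\ p]. The
    formula [Ex q] holds of some tuple satisfying [r], hence of [a]. *)
Lemma isolated_extend n (a : n.-tuple M) (p : formula L n.+1) : isolated a ->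
  (exists z, holds p (rcons_tuple a z)) ->
  exists z, holds p (rcons_tuple a z) /\ isolated (rcons_tuple a z).
Proof.
move=> [r comp_r ra] [z pz].
have [|q [comp_q [c qc] sub]] :=
    @isolated_dense _ (And (weaken r) p) (rcons_tuple a z).
  by apply/holds_And; rewrite holds_weaken.
have [c' [z' eq_c]] := tuple_rcons c.
have [rc _] : holds r c' /\ holds p c.
  by have /holds_And := sub _ qc; rewrite eq_c holds_weaken.
have /holds_Ex[w qw] : holds (Ex q) a.
  apply: (complete_holds comp_r rc _ ra).
  by apply/holds_Ex; exists z'; rewrite -eq_c.
exists w; split; last by exists q.
by have /holds_And[] := sub _ qw.
Qed.

(** The isolating formula defines the image, under extraction of the subtuple,
    of the set defined by a formula isolating the big tuple. *)
Lemma isolated_subtuple n (a : n.-tuple M) k (f : 'I_k -> 'I_n) :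
  isolated a -> isolated [tuple tnth a (f i) | i < k].
Proof.
move=> [p comp_p pa]; have [q qP] := image_definable p f.
exists q; last by apply/qP; exists a.
move=> r; have [all_r|all_nr] := comp_p (rename r f);
  [left|right] => _ /qP[c pc ->].
  by apply/holds_rename; apply: all_r.
by move/holds_rename; apply: all_nr.
Qed.

(** A countable elementary submodel whose tuples are all isolated is
    isomorphic to [M]. *)
Lemma all_isolated k (b : k.-tuple M) : isolated b.
Proof.
(* The empty tuple is isolated because the theory of [M] is complete. *)
have iso0 : isolated (nil_tuple M).
  exists Top; last by [].
  by move=> q; have [hq|nq] := pselect (holds q (nil_tuple M));
    [left|right] => a _; rewrite tuple0.
have [N [h [cN el_h _ isoN]]] :=
  countable_elementary_submodel iso0 isolated_extend.
have modN := elementary_model el_h modM.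
have [inf_models _ unique] := catT.
have [g _ el_g] := isomorphic_elementary
  (unique M N modM countM modN (conj cN (inf_models _ modN))).
have [n [a [f [iso_a eq_a]]]] := isoN _ (map_tuple g b).
have [p comp_p hp] := isolated_subtuple f iso_a.
by exists p => //; rewrite el_g el_h eq_a.
Qed.

(** If the types of the first [n] tuples never sufficed, a tuple of none of
    the types realized in [M] would exist by saturation. *)
Lemma finitely_many_types k : exists s : seq (formula L k),
  (forall i, i < size s -> complete (nth Bot s i)) /\
  forall a : k.-tuple M, exists2 i, i < size s & holds (nth Bot s i) a.
Proof.
have [e eP] := countable_tuples k (carrier_inhabited M) countM.1.
pose p n := s2val (cid2 (all_isolated (e n))).
have comp_p n : complete (p n) := s2valP (cid2 (all_isolated (e n))).
have p_e n : holds (p n) (e n) := s2valP' (cid2 (all_isolated (e n))).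
apply: contrapT => none.
have [|b nb] := @countably_saturated k (fun n => Not (p n)).
  move=> n; apply: contrapT => cover; apply: none; exists (mkseq p n).
  rewrite size_mkseq; split=> [i ltin|a]; first by rewrite nth_mkseq.
  apply: contrapT => na; apply: cover; exists a => i ltin pa; apply: na.
  by exists i; rewrite ?nth_mkseq.
by have [n eq_b] := eP b; apply: (nb n); rewrite -eq_b; apply: p_e.
Qed.

(** The extension axioms. A complete formula satisfied by one tuple of distinct
    points is satisfied by such tuples only. *)
Lemma distinct_types k : exists (c : nat) (theta : 'I_c -> formula L k),
  [/\ forall i, complete (theta i),
      forall i, exists2 a : k.-tuple M, injective (tnth a) & holds (theta i) a
    & forall a : k.-tuple M, injective (tnth a) -> exists i, holds (theta i) a].
Proof.
have [s [comp_s cover]] := finitely_many_types k.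
pose A := [pred i : 'I_(size s) | `[< exists2 a : k.-tuple M,
  injective (tnth a) & holds (nth Bot s i) a >]].
exists #|A|, (fun j : 'I_#|A| => nth Bot s (enum_val j : 'I_(size s))).
split=> [i|i|a inj_a].
- exact: comp_s.
- by have /asboolP := enum_valP i.
have [i lti hi] := cover a.
have Ai : Ordinal lti \in A by apply/asboolP; exists a.
by exists (enum_rank_in Ai (Ordinal lti)); rewrite enum_rankK_in.
Qed.

Lemma injective_extend k (a : k.-tuple M) : injective (tnth a) ->
  exists z, injective (tnth (rcons_tuple a z)).
Proof.
move=> inj_a.
have [z za] : exists z, forall i, z <> tnth a i.
  apply: contrapT => nz; case: countM => _; apply.
  apply: (@sub_finite_set _ _ (tnth a @` [set: 'I_k])).
    move=> z _; apply: contrapT => nza; apply: nz; exists z => i eqz.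
    by apply: nza; exists i.
  by apply: finite_image; apply: finite_finset.
by exists z; apply/injective_rcons.
Qed.

Lemma categorical_extension_properties : extension_properties T.
Proof.
pose c k := sval (cid (distinct_types k)).
have thetaP k := svalP (cid (distinct_types k)).
pose theta k := sval (cid (thetaP k)) : 'I_(c k) -> formula L k.
have comp k : forall i, complete (theta k i) by case: (svalP (cid (thetaP k))).
have sat k : forall i, exists2 a : k.-tuple M,
  injective (tnth a) & holds (theta k i) a by case: (svalP (cid (thetaP k))).
have cover k : forall a : k.-tuple M, injective (tnth a) ->
  exists i, holds (theta k i) a by case: (svalP (cid (thetaP k))).
exists c, theta; split.
- move=> k _; apply/entails_satisfies/satisfies_Alls_Imp => a.
  move=> /holds_distinct inj_a.
  by apply/holds_bigOr; apply: cover.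
- split=> [k _ i|j]; last first.
    apply/entails_satisfies/holds_Ex; have [a _] := sat 1 j.
    have [a' [z ->]] := tuple_rcons a => ha; exists z.
    by rewrite (tuple0 (nil_tuple M)) -(tuple0 a').
  (* The types of extensions of tuples satisfying [theta k i]. *)
  pose J := [pred j : 'I_(c k.+1) | `[< exists (a : k.-tuple M) z,
    holds (theta k i) a /\ holds (theta k.+1 j) (rcons_tuple a z) >]].
  exists #|J|; split; last 1 first.
  + exists enum_val; split=> [n|].
      apply/entails_satisfies/satisfies_Alls_Imp => b hb.
      have /asboolP[a [z [ha haz]]] := enum_valP n.
      by apply: (complete_holds (comp k i) ha _ hb); apply/holds_Ex; exists z.
    apply/entails_satisfies/satisfies_Alls_Imp => a ha z.
    move=> /holds_fresh fresh_z.
    apply/holds_bigOr.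
    have inj_a : injective (tnth a).
      have [b /holds_distinct inj_b hb] := sat k i.
      by apply/holds_distinct; apply: (complete_holds (comp k i) hb inj_b ha).
    have [|j hj] := cover k.+1 (rcons_tuple a z); first exact/injective_rcons.
    have Jj : j \in J by apply/asboolP; exists a, z.
    by exists (enum_rank_in Jj j); rewrite enum_rankK_in.
  + have [a /injective_extend[z inj_az] ha] := sat k i.
    have [j hj] := cover k.+1 _ inj_az.
    by apply/card_gt0P; exists j; apply/asboolP; exists a, z.
  + by apply: leq_trans (max_card _) _; rewrite card_ord.
- move=> k _ i; apply/entails_satisfies/satisfies_Alls_Imp => a ha.
  have [b /holds_distinct inj_b hb] := sat k i.
  exact: (complete_holds (comp k i) hb inj_b ha).
move=> k _ i; have [b _ hb] := sat k i; exists (diagram_of b).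
split; first exact: atomic_diagram_of.
apply/entails_satisfies/satisfies_Alls_Imp => a ha.
exact: (complete_holds (comp k i) hb (@holds_diagram_of _ _ _ b) ha).
Qed.

End Categorical.

(** * Back and forth *)

(** [G s] is the graph of the finite partial map approximated at stage [s]. *)
Lemma back_and_forth (M N S : Type) (G : S -> M -> N -> Prop) (s0 : S)
    (dM : nat -> M) (dN : nat -> N) :
  (forall x, exists n, dM n = x) -> (forall y, exists n, dN n = y) ->
  (forall s x, exists2 s', (forall u v, G s u v -> G s' u v)
     & exists y, G s' x y) ->
  (forall s y, exists2 s', (forall u v, G s u v -> G s' u v)
     & exists x, G s' x y) ->
  (forall s x y x' y', G s x y -> G s x' y' -> x = x' <-> y = y') ->
  exists2 f : M -> N, bijective f &
    forall k (t : k.-tuple M), exists s,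
      forall i, G s (tnth t i) (f (tnth t i)).
Proof.
move=> surM surN forth back one_one.
have next n s : exists s', [/\ forall u v, G s u v -> G s' u v,
    exists y, G s' (dM n) y & exists x, G s' x (dN n)].
  have [s1 sub1 [y hy]] := forth s (dM n); have [s2 sub2 ex2] := back s1 (dN n).
  exists s2; split=> [u v /sub1 /sub2//| |//].
  by exists y; apply: sub2.
pose step n s := sval (cid (next n s)).
have stepP n s : [/\ forall u v, G s u v -> G (step n s) u v,
    exists y, G (step n s) (dM n) y & exists x, G (step n s) x (dN n)].
  exact: svalP (cid (next n s)).
pose fix st n := if n is m.+1 then step m (st m) else s0.
have st_mono m n u v : m <= n -> G (st m) u v -> G (st n) u v.
  move/subnK => <-; elim: (n - m) => //= d IH /IH.
  by case: (stepP (d + m) (st (d + m))) => sub _ _; apply: sub.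
have /choice[f fP] : forall x, exists y n, G (st n) x y.
  move=> x; have [n <-] := surM x; have [_ [y hy] _] := stepP n (st n).
  by exists y, n.+1.
have /choice[g gP] : forall y, exists x n, G (st n) x y.
  move=> y; have [n <-] := surN y; have [_ _ [x hx]] := stepP n (st n).
  by exists x, n.+1.
have st_one m n x y x' y' : G (st m) x y -> G (st n) x' y' -> x = x' <-> y = y'.
  move=> /(st_mono m (maxn m n) x y (leq_maxl _ _)) hxy.
  by move=> /(st_mono n (maxn m n) x' y' (leq_maxr _ _)); apply: one_one.
exists f.
  exists g => [x|y].
    have [n hn] := fP x; have [m hm] := gP (f x).
    by apply/(st_one _ _ _ _ _ _ hm hn).
  have [n hn] := gP y; have [m hm] := fP (g y).
  by apply/(st_one _ _ _ _ _ _ hm hn).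
move=> k t.
have /choice[n nP] : forall i, exists n, G (st n) (tnth t i) (f (tnth t i)).
  by move=> i; apply: fP.
exists (st (\max_i n i)) => i; apply: st_mono (nP i).
exact: leq_bigmax.
Qed.

(** * Theories with extension properties *)

Section Extension.
Variables (L : vocabulary) (T : theory L).
Hypothesis satT : satisfiable T.
Variables (c : nat -> nat) (theta : forall k, 'I_(c k) -> formula L k).
Hypotheses (coverT : forall k, 0 < k -> entails T (sigma theta k))
  (extendT : forall k, 0 < k -> forall i : 'I_(c k),
     exists m, [/\ 1 <= m, m <= c k.+1 & exists j : 'I_m -> 'I_(c k.+1),
       (forall n : 'I_m, entails T (tau theta i (j n))) /\
       entails T (xi theta i j)])
  (startT : forall j : 'I_(c 1), entails T (tau0 theta j))
  (distinctT : forall k, 0 < k -> forall i : 'I_(c k),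
     entails T (Alls (Imp (theta i) (distinct L k))))
  (diagramT : forall k, 0 < k -> forall i : 'I_(c k),
     exists R : formula L k,
       atomic_diagram R /\ entails T (Alls (Imp (theta i) R))).

Lemma theta_distinct (M : structure L) k (i : 'I_(c k)) (a : k.-tuple M) :
  model T M -> 0 < k -> holds (theta i) a -> injective (tnth a).
Proof.
move=> modM k0 ha; apply/holds_distinct.
by move/satisfies_Alls_Imp: (distinctT k0 i modM); apply.
Qed.

Lemma theta_start (M : structure L) : model T M ->
  forall z : M, exists i, holds (theta i) [tuple z].
Proof.
move=> modM z; move/satisfies_Alls_Imp: (coverT (ltn0Sn 0) modM) => cover.
apply/holds_bigOr; apply: cover; apply/holds_distinct => i j _.
by rewrite !ord1.
Qed.

Lemma theta_start_ex (M : structure L) (j : 'I_(c 1)) : model T M ->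
  exists z : M, holds (theta j) [tuple z].
Proof.
move=> modM; have /holds_Ex[z hz] := @startT j M modM; exists z.
by rewrite (_ : [tuple z] = rcons_tuple (nil_tuple M) z) //; apply: val_inj.
Qed.

(** In [M] the axiom [xi] says which extension axiom the tuple extended by [z]
    satisfies; in [N] the corresponding axiom [tau] gives a counterpart [w]. *)
Lemma theta_extend (M N : structure L) k (i : 'I_(c k)) (a : k.-tuple M)
    (b : k.-tuple N) z :
  model T M -> model T N -> 0 < k -> holds (theta i) a -> holds (theta i) b ->
  (forall l, z <> tnth a l) ->
  exists (j : 'I_(c k.+1)) w,
    holds (theta j) (rcons_tuple a z) /\ holds (theta j) (rcons_tuple b w).
Proof.
move=> modM modN k0 ha hb fresh_z.
have [m [_ _ [j [tau_j xi_j]]]] := extendT k0 i.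
have /satisfies_Alls_Imp/(_ a ha z) h := xi_j M modM.
have /holds_bigOr[n hn] := h ((holds_fresh a z).2 fresh_z).
have /satisfies_Alls_Imp/(_ b hb)/holds_Ex[w hw] := tau_j n N modN.
by exists (j n), w.
Qed.

Lemma theta_realized (M : structure L) k : model T M ->
  exists (i : 'I_(c k.+1)) (a : k.+1.-tuple M), holds (theta i) a.
Proof.
move=> modM; elim: k => [|k [i [a ha]]].
  have [z] := carrier_inhabited M; have [i hi] := theta_start modM z.
  by exists i, [tuple z].
have [m [m0 _ [j [tau_j _]]]] := extendT (ltn0Sn k) i.
have /satisfies_Alls_Imp/(_ a ha)/holds_Ex[w hw] := tau_j (Ordinal m0) M modM.
by exists (j (Ordinal m0)), (rcons_tuple a w).
Qed.

(** The axioms [tau] produce tuples of distinct points of every size. *)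
Lemma extension_infinite (M : structure L) : model T M -> infinite_set [set: M].
Proof.
move=> modM /finite_set_leP[n /pcard_leP/injfunPex[f f_lt inj_f]].
have [i [a /(theta_distinct modM (ltn0Sn n)) inj_a]] := theta_realized n modM.
have lt_f l : f (tnth a l) < n by apply: f_lt.
have inj_g : injective (fun l => Ordinal (lt_f l)).
  by move=> l l' [/inj_f eq_a]; apply: inj_a; apply: eq_a; rewrite in_setT.
by have := leq_card _ inj_g; rewrite !card_ord ltnn.
Qed.

(** A stage of the back and forth. *)
Record matching (M N : structure L) := Matching {
  len : nat;
  axiom : 'I_(c len);
  left_tuple : len.-tuple M;
  right_tuple : len.-tuple N;
  len_gt0 : 0 < len;
  left_axiom : holds (theta axiom) left_tuple;
  right_axiom : holds (theta axiom) right_tuple }.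

Definition paired (M N : structure L) (s : matching M N) x y :=
  exists i, x = tnth (left_tuple s) i /\ y = tnth (right_tuple s) i.

Definition swap (M N : structure L) (s : matching M N) : matching N M :=
  Matching (len_gt0 s) (right_axiom s) (left_axiom s).

Lemma paired_swap (M N : structure L) (s : matching M N) x y :
  paired (swap s) y x <-> paired s x y.
Proof. by split=> -[i []]; exists i. Qed.

Lemma matching_start (M N : structure L) : model T M -> model T N ->
  inhabited (matching M N).
Proof.
move=> modM modN; have [z] := carrier_inhabited M.
have [i hz] := theta_start modM z; have [w hw] := theta_start_ex i modN.
by constructor; apply: (Matching (ltn0Sn 0) hz hw).
Qed.

Lemma matching_extend (M N : structure L) (s : matching M N) (x : M) :
  model T M -> model T N ->
  exists2 s', (forall u v, paired s u v -> paired s' u v)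
    & exists y, paired s' x y.
Proof.
move=> modM modN; case: s => k i a b k0 ha hb.
have [[l eq_x]|old] := pselect (exists l, x = tnth a l).
  by exists (Matching k0 ha hb) => //; exists (tnth b l), l.
have [|j [y [hx hy]]] := theta_extend (z := x) modM modN k0 ha hb.
  by move=> l eq_x; apply: old; exists l.
exists (Matching (ltn0Sn k) hx hy) => [u v [l [-> ->]]|].
  by exists (lift ord_max l); rewrite /= !tnth_rcons_lift.
by exists y, ord_max; rewrite /= !tnth_rcons_max.
Qed.

Lemma extension_isomorphic (M N : structure L) :
  model T M -> countably_infinite M -> model T N -> countably_infinite N ->
  isomorphic M N.
Proof.
move=> modM [cM _] modN [cN _].
have [dM surM] := countable_surjection (carrier_inhabited M) cM.
have [dN surN] := countable_surjection (carrier_inhabited N) cN.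
have [s0] := matching_start modM modN.
have [s x|s y|s x y x' y' [i [-> ->]] [j [-> ->]]|f bij_f fP] :=
  @back_and_forth M N (matching M N) (@paired M N) s0 dM dN surM surN.
- exact: matching_extend.
- have [s' sub [x hx]] := matching_extend (swap s) y modN modM.
  exists (swap s') => [u v /paired_swap /sub huv|]; first exact/paired_swap.
  by exists x; apply/paired_swap.
- have inj_a := theta_distinct modM (len_gt0 s) (left_axiom s).
  have inj_b := theta_distinct modN (len_gt0 s) (right_axiom s).
  by split=> [/inj_a->|/inj_b->].
exists f; split=> // P v; have [s /choice[w wP]] := fP _ v.
have eq_v : v = map_tuple (tnth (left_tuple s)) [tuple w i | i < arity P].
  by apply: eq_from_tnth => i; rewrite tnth_map tnth_mktuple (wP i).1.
have eq_fv : map_tuple f v =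
    map_tuple (tnth (right_tuple s)) [tuple w i | i < arity P].
  by apply: eq_from_tnth => i; rewrite !tnth_map tnth_ord_tuple (wP i).2.
have [_ [[[E [D ->]] _] RT]] := diagramT (len_gt0 s) (axiom s).
have /satisfies_Alls_Imp/(_ _ (left_axiom s)) ha := RT M modM.
have /satisfies_Alls_Imp/(_ _ (right_axiom s)) hb := RT N modN.
by rewrite eq_fv {1}eq_v; apply: holds_diagram_rel ha hb.
Qed.

Lemma extension_omega_categorical : omega_categorical T.
Proof.
split; [exact: extension_infinite| |exact: extension_isomorphic].
have [M modM] := satT.
have [N [h [cN el_h _]]] := lowenheim_skolem (nil_tuple M).
have modN := elementary_model el_h modM.
by exists N => //; split=> //; apply: extension_infinite.
Qed.

End Extension.

Theorem fact4p2 (L : vocabulary) (T : theory L) (hT : satisfiable T) :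
  omega_categorical T <-> extension_properties T.
Proof.
split=> [catT|[c [theta [coverT [extendT startT] distinctT diagramT]]]].
  have [_ [M modM countM] _] := catT.
  exact: (categorical_extension_properties catT modM countM).
exact: (extension_omega_categorical hT coverT extendT startT distinctT
  diagramT).
Qed.
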